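(* Let $W$ be a Coxeter group with simple generators $S$, let $\Omega$ be an orientation of its Coxeter diagram $\Gamma$, and let $w\in W$. Then $\pi_\downarrow^{\Omega}(w)\le w$ in the weak order, with equality if and only if $w$ is $\Omega$-sortable.
   Context: $W$ is a Coxeter group with finite set $S$ of simple generators; $\ell$ is the length function and $e$ the identity. The (right) weak order on $W$ sets $u\le w$ if and only if $\ell(u)+\ell(u^{-1}w)=\ell(w)$. For $J\subseteq S$, $W_J$ is the standard parabolic subgroup generated by $J$. The Coxeter diagram $\Gamma$ is the graph with vertex set $S$ in which distinct $s,t$ are joined by an edge if and only if they do not commute. $\Omega$ is an arbitrary orientation of $\Gamma$ (each edge is given one direction; directed cycles are allowed). A subset $J\subseteq S$ is $\Omega$-acyclic if the induced subgraph of $\Gamma$ on $J$, oriented by $\Omega$, has no directed cycle. For $\Omega$-acyclic $J$, $c(\Omega,J)=s_1s_2\cdots s_k$, where $s_1,\ldots,s_k$ is any ordering of $J$ such that $i<j$ whenever there is an edge oriented $s_j\to s_i$ (the product does not depend on the ordering; $c(\Omega,\emptyset)=e$). $J(w,\Omega)$ denotes the unique maximal (under inclusion) element among the $\Omega$-acyclic subsets $J'\subseteq S$ with $w\ge c(\Omega,J')$ (it is a fact that there is a unique maximal one, which therefore contains all the others). $\Omega$-sortable elements: given $w\in W$, set $w_1=w$ and, inductively, $J_i=J(w_i,\Omega)$, $w_{i+1}=c(\Omega,J_i)^{-1}w_i$ (so $J_i=\emptyset$ for $i$ large). The element $w$ is $\Omega$-sortable if $J_1\supseteq J_2\supseteq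 J_3\supseteq\cdots$. For $w\in W$, $\mathrm{inv}(w)$ is the set of reflections $t$ (conjugates of elements of $S$) with $\ell(tw)<\ell(w)$. For $J\subseteq S$, $w_J$ is the unique element of $W_J$ with $\mathrm{inv}(w_J)=\mathrm{inv}(w)\cap W_J$. The map $\pi_\downarrow^\Omega:W\to W$ is defined recursively by $\pi_\downarrow^\Omega(e)=e$ and, for $w\neq e$, with $J=J(w,\Omega)$, $\pi_\downarrow^{\Omega}(w)=c(\Omega,J)\,\pi_\downarrow^{\Omega}\bigl(c(\Omega,J)^{-1}w_J\bigr)$. *)

(* Defs.v *)
From HB Require Import structures.
From mathcomp Require Import all_boot.
From mathcomp Require Import boolp classical_sets.

Set Implicit Arguments.
Unset Strict Implicit.
Unset Printing Implicit Defensive.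

Local Open Scope classical_set_scope.
Local Open Scope group_scope.

(* The entry 0 of a Coxeter matrix stands for infinity: the relator
   (s t) ^ 0 is then the empty word, i.e., no relation is imposed. *)
Definition coxeter_matrix (S : eqType) (m : S -> S -> nat) : Prop :=
  [/\ forall s, m s s = 1%N,
      forall s t, m s t = m t s
    & forall s t, s != t -> m s t != 1%N].

(* Equality of words in the group < S | (s t) ^ m(s,t) = 1 >: insertion and
   deletion of relators. As m s s = 1 makes the generators involutions, the
   group presentation is also a monoid presentation, so that words need not
   contain formal inverses. *)
Inductive coxeter_equiv (S : Type) (m : S -> S -> nat) :
    seq S -> seq S -> Prop :=
| CoxRelator u v s t :
    coxeter_equiv m (u ++ flatten (nseq (m s t) [:: s; t]) ++ v) (u ++ v)
| CoxRefl u : coxeter_equiv m u u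
| CoxSym u v : coxeter_equiv m u v -> coxeter_equiv m v u
| CoxTrans u v w :
    coxeter_equiv m u v -> coxeter_equiv m v w -> coxeter_equiv m u w.

Record coxeterSystem := CoxeterSystem {
  cox_group :> groupType;
  simple : finType;
  simple_gen : simple -> cox_group;
  cox_mat : simple -> simple -> nat;
  cox_matP : coxeter_matrix cox_mat;
  cox_generated : forall w : cox_group,
    exists l : seq simple, w = \prod_(s <- l) simple_gen s;
  cox_presented : forall u v : seq simple,
    \prod_(s <- u) simple_gen s = \prod_(s <- v) simple_gen s <->
    coxeter_equiv cox_mat u v
}.

Section CoxeterGroup.
Variable W : coxeterSystem.
Local Notation S := (simple W).

Definition wprod (l : seq S) : W := \prod_(s <- l) simple_gen s.

Definition has_word (w : W) (n : nat) : bool :=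
  [exists l : n.-tuple S, wprod l == w].

Fact has_word_exists (w : W) : exists n, has_word w n.
Proof.
have [l ->] := cox_generated w.
by exists (size l); apply/existsP; exists (in_tuple l).
Qed.

Definition len (w : W) : nat := ex_minn (has_word_exists w).

Definition weak_le (u w : W) : Prop := (len u + len (u^-1 * w))%N = len w.

Definition is_subgroup (H : set W) : Prop :=
  H 1 /\ forall x y, H x -> H y -> H (x / y).

Definition parabolic (J : {set S}) : set W :=
  smallest is_subgroup [set simple_gen s | s in [set` J]].

Definition reflection (t : W) : Prop :=
  exists (x : W) (s : S), t = x * simple_gen s * x^-1.

Definition inversions (w : W) : set W :=
  [set t | reflection t /\ (len (t * w) < len w)%N].

(* The element w_J. *)
Definition parabolic_part (J : {set S}) (w : W) : W :=
  xget 1 [set v | parabolic J v /\ inversions v = inversions w `&` parabolic J].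

Definition adjacent (s t : S) : bool :=
  (s != t) && (simple_gen s * simple_gen t != simple_gen t * simple_gen s).

End CoxeterGroup.

(* [arrow s t] is an edge oriented s -> t. *)
Record orientation (W : coxeterSystem) := Orientation {
  arrow :> rel (simple W);
  arrow_adjacent : forall s t, arrow s t || arrow t s = adjacent s t;
  arrow_asym : forall s t, ~~ (arrow s t && arrow t s)
}.

Section Sortable.
Variables (W : coxeterSystem) (Omega : orientation W).
Local Notation S := (simple W).

Definition acyclic (J : {set S}) : Prop :=
  ~ exists p : seq S, [/\ p != [::], {subset p <= J} & ucycle Omega p].

Definition compatible_ordering (J : {set S}) (l : seq S) : Prop :=
  [/\ uniq l, l =i J
    & forall s t, s \in J -> t \in J -> Omega t s ->
        (index s l < index t l)%N].

(* The element c(Omega, J); meaningful for acyclic J only. *)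
Definition cox_elt (J : {set S}) : W :=
  xget 1 [set wprod l | l in compatible_ordering J].

Definition acyclic_below (w : W) (J : {set S}) : Prop :=
  acyclic J /\ weak_le (cox_elt J) w.

(* The set J(w, Omega). *)
Definition max_acyclic (w : W) : {set S} :=
  xget finset.set0
    [set J | maxset (fun J' => `[< acyclic_below w J' >]) J].

(* The sequence w_1, w_2, ... with indices shifted to start at 0. *)
Definition sort_step (w : W) (i : nat) : W :=
  iter i (fun x => (cox_elt (max_acyclic x))^-1 * x) w.

Definition sortable (w : W) : Prop :=
  forall i, max_acyclic (sort_step w i.+1) \subset max_acyclic (sort_step w i).

(* The recursion defining the projection, with a bound on the number of
   recursive calls. If w != 1, then J(w, Omega) is nonempty and
   c(Omega, J) <= w_J, so that the argument of the recursive call has length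
   len w_J - #|J| < len w: the bound len w is never reached before 1 is. *)
Fixpoint pi_down_rec (n : nat) (w : W) : W :=
  if n is n'.+1 then
    if w == 1 then 1 else
    let J := max_acyclic w in
    cox_elt J * pi_down_rec n' ((cox_elt J)^-1 * parabolic_part J w)
  else 1.

Definition pi_down (w : W) : W := pi_down_rec (len w) w.

End Sortable.

(* Main.v *)
Require Import Defs.
From mathcomp Require Import all_boot all_algebra all_field ring.
From mathcomp Require Import boolp classical_sets.

(** The projection replaces [w] by its part [w_J] in the parabolic subgroup
    generated by [J = J(w, Omega)], strips the factor [c = c(Omega, J)] off it,
    and recurses. Here [w_J <= w], by comparison of inversions. As [c <= w] and
    [c] lies in [W_J], also [c <= w_J]; hence multiplying an element below
    [c^-1 w_J] by [c] gives an element below [w_J] ([weak_le_mul]).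
    By induction on the length the projection of [w] is therefore [<= w_J <= w].
    Equality forces [w = w_J], so that [w] is in [W_J], and forces [c^-1 w] to be
    its own projection, hence sortable by induction. As [W_J] is a lower set of
    the weak order ([parabolic_weak_le]), the next set [J(c^-1 w, Omega)] is
    contained in [J], and [w] is sortable. Conversely, a sortable [w] is a
    product of elements [c(Omega, J_i)] with all [J_i] contained in [J], so that
    [w = w_J], and the induction hypothesis applies to [c^-1 w].

    These steps rest on the theory of Coxeter groups, derived here from the
    presentation. A word [s_1 ... s_k] determines reflections
    [s_1 ... s_i ... s_1], and the parity of the number of occurrences of a
    reflection [t] among them depends only on the product [w] of the word,
    because in a relator every reflection occurs an even number of times
    ([crosses_relator]). This parity, [odd_inv w t], satisfies a cocycle identity
    ([odd_invM]) and decides whether [t w] is shorter than [w] ([odd_invP]).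
    It follows that the weak order is containment of inversion sets, and that
    [w_J] exists ([parabolic_part_exists]).

    The presentation must also not identify two generators: otherwise
    [c(Omega, J)] could be trivial for a nonempty [J]. This is seen on a linear
    representation with algebraic coefficients ([simple_gen_inj]). It implies
    that a product of distinct generators is in [W_K] only if all of them are in
    [K] ([uniq_word_parabolic]), which lets [J] be read off [c(Omega, J)]. *)

Set Implicit Arguments.
Unset Strict Implicit.
Unset Printing Implicit Defensive.

Local Open Scope group_scope.

(** * Words and reflections *)

Section Words.
Variable W : coxeterSystem.
Local Notation S := (simple W).
Local Notation gen := (@simple_gen W).

Lemma wprod_nil : wprod [::] = 1 :> W.
Proof. exact: big_nil. Qed.

Lemma wprod_cons (s : S) l : wprod (s :: l) = gen s * wprod l.
Proof. exact: big_cons. Qed.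

Lemma wprod_cat (u v : seq S) : wprod (u ++ v) = wprod u * wprod v.
Proof. exact: big_cat. Qed.

Lemma wprod_alternating (s t : S) n :
  wprod (flatten (nseq n [:: s; t])) = (gen s * gen t) ^+ n.
Proof.
elim: n => [|n IH]; first exact: wprod_nil.
by rewrite expgS /= !wprod_cons IH mulgA.
Qed.

Lemma relator_eq1 (s t : S) : (gen s * gen t) ^+ cox_mat s t = 1.
Proof.
rewrite -wprod_alternating -wprod_nil; apply/cox_presented.
by have := CoxRelator (@cox_mat W) [::] [::] s t; rewrite cats0.
Qed.

Lemma mulgen (s : S) : gen s * gen s = 1.
Proof. by have := relator_eq1 s s; have [-> _ _] := cox_matP W. Qed.

Lemma gen_inv (s : S) : (gen s)^-1 = gen s.
Proof. exact/mulg1_eq/mulgen. Qed.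

Lemma wprod_rev (l : seq S) : wprod (rev l) = (wprod l)^-1.
Proof.
elim: l => [|s l IH]; first by rewrite wprod_nil invg1.
by rewrite rev_cons -cats1 wprod_cat IH !wprod_cons wprod_nil mulg1 invgM
  gen_inv.
Qed.

Lemma reduced_word_exists (w : W) :
  exists l : seq S, wprod l = w /\ size l = len w.
Proof.
rewrite /len; case: ex_minnP => n /existsP[l /eqP lw] _.
by exists l; rewrite size_tuple.
Qed.

Lemma len_wprod (l : seq S) : (len (wprod l) <= size l)%N.
Proof.
rewrite /len; case: ex_minnP => n _; apply.
by apply/existsP; exists (in_tuple l).
Qed.

Lemma len1 : len (1 : W) = 0%N.
Proof. by apply/eqP; rewrite -leqn0 -wprod_nil len_wprod. Qed.

Lemma len_eq0 (w : W) : len w = 0%N -> w = 1.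
Proof.
have [l [<- <-]] := reduced_word_exists w.
by move/size0nil->; exact: wprod_nil.
Qed.

Lemma lenM (x y : W) : (len (x * y) <= len x + len y)%N.
Proof.
have [u [<- <-]] := reduced_word_exists x.
have [v [<- <-]] := reduced_word_exists y.
by rewrite -wprod_cat -size_cat len_wprod.
Qed.

Lemma len_gen (s : S) : (len (gen s) <= 1)%N.
Proof.
have := len_wprod [:: s]; by rewrite wprod_cons wprod_nil mulg1.
Qed.

Lemma gen_reflection (s : S) : reflection (gen s).
Proof. by exists 1, s; rewrite mul1g invg1 mulg1. Qed.

Lemma reflectionJ (t x : W) : reflection t -> reflection (t ^ x).
Proof.
by case=> y [s ->]; exists (x^-1 * y), s; rewrite conjgE invgM invgK !mulgA.
Qed.

(** The reflections [s_1 ... s_i ... s_1] attached to the positions of a word;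
    multiplying by the [i]-th one on the left deletes the [i]-th letter. *)
Fixpoint refls (l : seq S) : seq W :=
  if l is s :: l' then gen s :: [seq t ^ (gen s)^-1 | t <- refls l'] else [::].

Lemma refls_cat u v :
  refls (u ++ v) = refls u ++ [seq t ^ (wprod u)^-1 | t <- refls v].
Proof.
elim: u => [|s u IH] /=.
  by rewrite wprod_nil invg1 (eq_map (@conjg1 _)) map_id.
rewrite IH map_cat -map_comp wprod_cons; congr (_ :: _ ++ _).
by apply: eq_map => t /=; rewrite invgM conjgM.
Qed.

Lemma refls_reflection l t : t \in refls l -> reflection t.
Proof.
elim: l t => [//|s l IH] t; rewrite inE => /predU1P[-> |].
  exact: gen_reflection.
by case/mapP=> t' /IH t'P ->; apply: reflectionJ.
Qed.

Lemma mem_refls l t : t \in refls l ->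
  exists u s v, l = u ++ s :: v /\ t = gen s ^ (wprod u)^-1.
Proof.
elim: l t => [//|s l IH] t; rewrite inE => /predU1P[-> |].
  by exists [::], s, l; rewrite wprod_nil invg1 conjg1.
case/mapP=> t' /IH[u [s' [v [-> ->]]]] ->; exists (s :: u), s', v.
by rewrite -conjgM wprod_cons invgM.
Qed.

Lemma refl_deletion u s v :
  (gen s ^ (wprod u)^-1) * wprod (u ++ s :: v) = wprod (u ++ v).
Proof.
rewrite !wprod_cat wprod_cons conjgE invgK !mulgA mulgVK.
by rewrite -[X in X * _]mulgA mulgen mulg1.
Qed.

Lemma count_mem_conj t x (r : seq W) :
  count_mem t [seq y ^ x^-1 | y <- r] = count_mem (t ^ x) r.
Proof.
rewrite count_map; apply: eq_count => y /=.
by apply/eqP/eqP => [<-|->]; rewrite ?conjgKV ?conjgK.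
Qed.

(** * Parity of crossings *)

(** The hyperplane of [t] is crossed an odd number of times by the gallery that
    the word describes. *)
Definition crosses (l : seq S) (t : W) : bool := odd (count_mem t (refls l)).

Lemma crosses_cat u v t :
  crosses (u ++ v) t = crosses u t (+) crosses v (t ^ wprod u).
Proof. by rewrite /crosses refls_cat count_cat oddD count_mem_conj. Qed.

Lemma refls_alternating (s t : S) n :
  refls (flatten (nseq n [:: s; t])) =
  [seq (gen s * gen t) ^+ i * gen s | i <- iota 0 (n + n)].
Proof.
elim: n => [//|n IH].
rewrite addSn addnS /= IH; congr [:: _, _ & _].
- by rewrite mul1g.
- by rewrite conjgE invgK gen_inv mulgA.
rewrite -!map_comp (iotaDl 2 0) -map_comp.
apply: eq_map => i /=; rewrite add2n expgS expgSr.
rewrite !conjgE !invgK !gen_inv !mulgA; congr (_ * _).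
Qed.

(** With [r = st] of order dividing [m], the reflections [r^i s] of the relator
    word repeat with period [m], so that each occurs an even number of times. *)
Lemma crosses_relator (s t : S) x :
  crosses (flatten (nseq (cox_mat s t) [:: s; t])) x = false.
Proof.
rewrite /crosses refls_alternating iotaD addnC map_cat count_cat.
rewrite (iotaDl _ 0) -map_comp oddD; set A := [seq _ | _ <- _].
set B := [seq _ | _ <- _]; suff -> : B = A by rewrite addbb.
by apply: eq_map => i /=; rewrite expgnDr relator_eq1 mul1g.
Qed.

Lemma crosses_equiv u v :
  coxeter_equiv (@cox_mat W) u v -> crosses u =1 crosses v.
Proof.
elim=> {u v}[u v s t x|//|u v _ IH x|u v w _ IHu _ IHv x].
- rewrite !crosses_cat crosses_relator /= wprod_alternating relator_eq1.
  by rewrite conjg1.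
- by rewrite IH.
- by rewrite IHu.
Qed.

(** Because the parity of crossings is independent of the word, it is a function
    [odd_inv w t] of the group element; it satisfies a cocycle identity, from
    which all facts about inversions below follow by computation. *)
Definition odd_inv (w t : W) : bool :=
  crosses (sval (cid (reduced_word_exists w))) t.

Lemma odd_invE l t : odd_inv (wprod l) t = crosses l t.
Proof.
rewrite /odd_inv; case: cid => u [uE _] /=.
by apply: crosses_equiv; apply/cox_presented.
Qed.

Lemma odd_invM x y t : odd_inv (x * y) t = odd_inv x t (+) odd_inv y (t ^ x).
Proof.
have [u [<- _]] := reduced_word_exists x.
have [v [<- _]] := reduced_word_exists y.
by rewrite -wprod_cat !odd_invE crosses_cat.
Qed.

Lemma odd_inv1 t : odd_inv 1 t = false.
Proof. by rewrite -wprod_nil odd_invE. Qed.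

Lemma odd_invV x t : odd_inv x^-1 t = odd_inv x (t ^ x^-1).
Proof.
have := odd_invM x^-1 x t; rewrite mulVg odd_inv1.
by move/esym; apply: contraFeq; case: odd_inv; case: odd_inv.
Qed.

Lemma odd_inv_gen (s : S) t : odd_inv (gen s) t = (t == gen s).
Proof.
have sE : wprod [:: s] = gen s by rewrite wprod_cons wprod_nil mulg1.
by rewrite -{1}sE odd_invE /crosses /= addn0 oddb eq_sym.
Qed.

Lemma odd_inv_reflection w t : odd_inv w t -> reflection t.
Proof.
have [u [<- _]] := reduced_word_exists w; rewrite odd_invE /crosses => tu.
apply: (@refls_reflection u); rewrite -has_pred1 has_count.
by case: count tu.
Qed.

Lemma odd_inv_self t : reflection t -> odd_inv t t.
Proof.
case=> x [s tE]; have st : t ^ x = gen s by rewrite tE conjgE !gnorm.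
have ss : gen s ^ gen s = gen s by rewrite conjgE mulgA mulVg mul1g.
rewrite {1}tE !odd_invM odd_invV conjgM st ss odd_inv_gen eqxx -st conjgK.
by case: odd_inv.
Qed.

End Words.

(** * Inversions and the weak order *)

Section WeakOrder.
Variable W : coxeterSystem.
Local Notation S := (simple W).
Local Notation gen := (@simple_gen W).

Lemma odd_inv_mem_refls l t : odd_inv (wprod l : W) t -> t \in refls l.
Proof.
by rewrite odd_invE /crosses -has_pred1 has_count => lt; case: count lt.
Qed.

Lemma conjg_self (x : W) : x ^ x = x.
Proof. by rewrite conjgE mulKg. Qed.

Lemma mulgenK (s : S) : involutive ( *%g (gen s)).
Proof. by move=> x; rewrite mulgA mulgen mul1g. Qed.

Lemma odd_inv_mul_self t w :
  reflection t -> odd_inv (t * w : W) t = ~~ odd_inv w t.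
Proof. by move=> tP; rewrite odd_invM odd_inv_self // conjg_self. Qed.

Lemma odd_inv_gen_mul (s : S) w t :
  odd_inv (gen s * w) (t ^ gen s) = (t == gen s) (+) odd_inv w t.
Proof.
rewrite odd_invM odd_inv_gen -conjgM mulgen conjg1.
by rewrite -{2}[gen s]conjg_self (inj_eq (@conjg_inj _ _)).
Qed.

Lemma len_odd_inv w t : odd_inv w t -> (len (t * w : W) < len w)%N.
Proof.
have [l [<- <-]] := reduced_word_exists w.
move=> /odd_inv_mem_refls/mem_refls[u [s [v [-> ->]]]].
by rewrite refl_deletion (leq_ltn_trans (len_wprod _)) // !size_cat /= addnS.
Qed.

Lemma reflection_invol t : reflection (t : W) -> t * t = 1.
Proof.
case=> x [s ->]; rewrite (_ : _ / _ = gen s ^ x^-1).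
  by rewrite -conjMg mulgen conj1g.
by rewrite conjgE invgK mulgA.
Qed.

(** As [t] crosses itself, exactly one of [w] and [t w] has [t] as an odd
    inversion; the strict decrease in the odd case then settles both. *)
Lemma odd_invP w t : reflection t -> odd_inv w t = (len (t * w : W) < len w)%N.
Proof.
move=> tP; apply/idP/idP => [/len_odd_inv //|]; apply: contraLR => wt.
have : odd_inv (t * w) t.
  by rewrite odd_inv_mul_self.
move/len_odd_inv; rewrite mulgA reflection_invol // mul1g -leqNgt.
exact: ltnW.
Qed.

Lemma inversionsE w : inversions w = [set t | odd_inv (w : W) t]%classic.
Proof.
apply/seteqP; split=> t /= => [[tP]|wt]; first by rewrite -odd_invP.
have tP := odd_inv_reflection wt; by split; rewrite // -odd_invP.
Qed.

Lemma len_gen_mul (s : S) w :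
  len w = if odd_inv w (gen s) then (len (gen s * w)).+1
          else (len (gen s * w)).-1.
Proof.
have le x : (len (gen s * x) <= (len x).+1)%N.
  by rewrite (leq_trans (lenM _ _)) // -add1n leq_add2r len_gen.
have := le (gen s * w); rewrite mulgenK => le1.
have sP := gen_reflection s; case: ifP => sw; apply/eqP.
  by rewrite eqn_leq le1 -odd_invP.
have : odd_inv (gen s * w) (gen s).
  by rewrite odd_inv_mul_self ?sw.
rewrite odd_invP // mulgenK => lt.
by rewrite eqn_leq -ltnS (ltn_predK lt) lt -ltnS (ltn_predK lt) le.
Qed.

Lemma reduced_cons (s : S) l : size (s :: l) = len (wprod (s :: l)) ->
  size l = len (wprod l) /\ odd_inv (wprod l) (gen s) = false.
Proof.
move=> /= sl; have := len_gen_mul s (wprod l); rewrite -wprod_cons -sl.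
by case: ifP => // _ e; have := len_wprod l; rewrite e ltnNge leqnSn.
Qed.

Lemma weak_leP (u w : W) :
  weak_le u w <-> exists v, w = u * v /\ len w = (len u + len v)%N.
Proof.
split=> [uw|[v [-> e]]]; last by rewrite /weak_le mulKg.
by exists (u^-1 * w); rewrite mulVKg.
Qed.

Lemma weak_le_refl (w : W) : weak_le w w.
Proof. by apply/weak_leP; exists 1; rewrite mulg1 len1 addn0. Qed.

Lemma weak_le1 (w : W) : weak_le 1 w.
Proof. by apply/weak_leP; exists w; rewrite mul1g len1. Qed.

Lemma weak_le_trans (u v w : W) : weak_le u v -> weak_le v w -> weak_le u w.
Proof.
move=> /weak_leP[x [-> vx]] /weak_leP[y [-> wy]].
apply/weak_leP; exists (x * y); rewrite mulgA; split=> //; apply/eqP.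
by rewrite eqn_leq -{1}mulgA lenM wy vx -addnA leq_add2l lenM.
Qed.

Lemma weak_le_mul (c u w : W) :
  weak_le c w -> weak_le u (c^-1 * w) -> weak_le (c * u) w.
Proof.
move=> /weak_leP[x [-> wx]]; rewrite mulKg => /weak_leP[y [xy ux]].
apply/weak_leP; exists y; rewrite -mulgA -xy; split=> //; apply/eqP.
have le1 := lenM (c * u) y; have le2 := lenM c u.
by rewrite eqn_leq {1}xy mulgA le1 wx ux addnA leq_add2r.
Qed.

Lemma weak_le_anti (u w : W) : weak_le u w -> weak_le w u -> u = w.
Proof.
move=> /weak_leP[x [-> ux]] /weak_leP[y [_ uy]].
have : len x = 0%N.
  by apply/eqP; rewrite -leqn0 -(leq_add2l (len u)) addn0 -ux uy leq_addr.
by move/len_eq0->; rewrite mulg1.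
Qed.

Lemma weak_le_gen (s : S) w : odd_inv w (gen s) -> weak_le (gen s) w.
Proof.
move=> sw; apply/weak_leP; exists (gen s * w); rewrite mulgenK.
split=> //; rewrite (len_gen_mul s w) sw.
rewrite (_ : len (gen s) = 1%N) //; apply/eqP; rewrite eqn_leq len_gen.
have := len_gen_mul s (gen s); rewrite odd_inv_gen eqxx.
by move->.
Qed.

(** Write [w = u v] with lengths adding up. If [t] were crossed by [u] and again
    by [v], then [u v = (t u) (t ^ u v)] would be a shorter factorization. *)
Lemma weak_le_odd_inv (u w : W) t : weak_le u w -> odd_inv u t -> odd_inv w t.
Proof.
move=> /weak_leP[v [-> uv]] ut; rewrite odd_invM ut /=.
apply: contraTN ut => vt; apply/negP => ut.
have tP := odd_inv_reflection ut.
have e : u * v = (t * u) * (t ^ u * v).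
  by rewrite conjgE !mulgA mulgK reflection_invol ?mul1g.
have := lenM (t * u) (t ^ u * v); rewrite -e uv leqNgt.
by rewrite (leq_ltn_trans (leq_add (leqnn _) (ltnW (len_odd_inv vt)))) //
  ltn_add2r len_odd_inv.
Qed.

(** The weak order is containment of inversion sets: a first letter [s] of [u]
    is an inversion of [w], and removing it from both preserves containment. *)
Lemma odd_inv_weak_le (u w : W) :
  (forall t, odd_inv u t -> odd_inv w t) -> weak_le u w.
Proof.
have [l [<- sl]] := reduced_word_exists u.
elim: l sl w {u} => [|s l IH] /= sl w uw.
  by rewrite wprod_nil; apply: weak_le1.
have [lenl ls] := reduced_cons sl.
rewrite wprod_cons in uw *.
have ws : odd_inv w (gen s).
  by apply: uw; rewrite odd_inv_mul_self ?ls //; apply: gen_reflection.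
apply: weak_le_mul; first exact: weak_le_gen.
apply: IH => // t lt; rewrite gen_inv -(conjgK (gen s) t) gen_inv.
rewrite odd_inv_gen_mul; set t' := t ^ gen s.
have t'ne : t' != gen s.
  apply: contraFneq ls => t'E; rewrite -(_ : t = gen s) //.
  by apply: (@conjg_inj _ (gen s)); rewrite conjg_self.
rewrite (negPf t'ne) /=; apply: uw; rewrite odd_inv_gen_mul lt addbT.
by apply: contraNneq t'ne => tE; rewrite /t' tE conjg_self.
Qed.

(** * Parabolic subgroups *)

Lemma parabolicP (J : {set S}) (x : W) :
  parabolic J x <-> exists l, {subset l <= J} /\ x = wprod l.
Proof.
split=> [|[l [lJ ->]]].
  pose X := [set y | exists l, {subset l <= J} /\ y = wprod l :> W]%classic.
  apply: (@smallest_sub _ _ _ X).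
    split=> [|y z [u [uJ ->]] [v [vJ ->]]].
      by exists [::]; rewrite wprod_nil; split.
    exists (u ++ rev v); rewrite wprod_cat wprod_rev; split=> // s.
    by rewrite mem_cat mem_rev => /orP[/uJ|/vJ].
  move=> _ [s sJ <-]; exists [:: s]; rewrite wprod_cons wprod_nil mulg1.
  by split=> // t; rewrite inE => /eqP ->.
move=> H [[H1 Hdiv] sub].
have HM y z : H y -> H z -> H (y * z).
  move=> Hy Hz; rewrite -[z]invgK; apply: (Hdiv) => //.
  by rewrite -[_^-1]mul1g; apply: Hdiv.
elim: l lJ => [|s l IH] lJ; first by rewrite wprod_nil.
rewrite wprod_cons; apply: HM; last first.
  by apply: IH => t tl; apply: lJ; rewrite inE tl orbT.
by apply: sub; exists s => //=; apply: lJ; rewrite mem_head.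
Qed.

Lemma parabolic_wprod (J : {set S}) l :
  {subset l <= J} -> parabolic J (wprod l : W).
Proof. by move=> lJ; apply/parabolicP; exists l. Qed.

Lemma parabolicM (J : {set S}) (x y : W) :
  parabolic J x -> parabolic J y -> parabolic J (x * y).
Proof.
move=> /parabolicP[u [uJ ->]] /parabolicP[v [vJ ->]].
rewrite -wprod_cat; apply: parabolic_wprod => s.
by rewrite mem_cat => /orP[/uJ|/vJ].
Qed.

Lemma parabolicV (J : {set S}) (x : W) : parabolic J x -> parabolic J x^-1.
Proof.
move=> /parabolicP[u [uJ ->]]; rewrite -wprod_rev.
by apply: parabolic_wprod => s; rewrite mem_rev => /uJ.
Qed.

Lemma parabolic1 (J : {set S}) : parabolic J (1 : W).
Proof. by rewrite -wprod_nil; apply: parabolic_wprod. Qed.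

Lemma parabolicS (J K : {set S}) (x : W) :
  J \subset K -> parabolic J x -> parabolic K x.
Proof.
move=> /fintype.subsetP JK /parabolicP[u [uJ ->]].
by apply: parabolic_wprod => s /uJ/JK.
Qed.

Lemma parabolicJ (J : {set S}) (x y : W) :
  parabolic J x -> parabolic J y -> parabolic J (x ^ y).
Proof.
by move=> xJ yJ; apply: parabolicM; [apply: parabolicV|apply: parabolicM].
Qed.

Lemma parabolic_refls (J : {set S}) (l : seq S) t :
  {subset l <= J} -> t \in refls l -> parabolic J (t : W).
Proof.
move=> lJ /mem_refls[u [s [v [lE ->]]]].
apply: parabolicJ.
  rewrite -[gen s]mulg1 -wprod_nil -wprod_cons; apply: parabolic_wprod => x.
  by rewrite inE => /eqP ->; apply: lJ; rewrite lE mem_cat mem_head orbT.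
apply: parabolicV; apply: parabolic_wprod => x xu; apply: lJ.
by rewrite lE mem_cat xu.
Qed.

Lemma parabolic_odd_inv (J : {set S}) (w t : W) :
  parabolic J w -> odd_inv w t -> parabolic J t.
Proof.
move=> /parabolicP[l [lJ ->]] /odd_inv_mem_refls; exact: parabolic_refls.
Qed.

(** By induction on the word: prefixing a letter to a reduced word either gives a
    reduced word or, by exchange, has the same effect as deleting a letter. *)
Lemma reduced_subseq (l : seq S) : exists k : seq S,
  [/\ {subset k <= l}, wprod k = wprod l :> W & size k = len (wprod l : W)].
Proof.
elim: l => [|s l [k [kl kE sk]]].
  by exists [::]; rewrite wprod_nil len1.
have := len_gen_mul s (wprod (s :: l)).
rewrite wprod_cons mulgenK; case: ifP => [_ e|].
  exists (s :: k); rewrite wprod_cons kE /= sk e; split=> // t.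
  by rewrite !inE => /orP[->//|/kl ->]; rewrite orbT.
rewrite odd_inv_mul_self; last exact: gen_reflection.
move/negbFE.
rewrite -kE => /odd_inv_mem_refls/mem_refls[u [s' [v [kuv sE]]]] e.
exists (u ++ v); rewrite -(refl_deletion u s' v) -kuv -sE e kE -sk kuv.
rewrite !size_cat /= addnS; split=> // t; rewrite mem_cat inE => tuv.
by rewrite kl ?orbT // kuv mem_cat inE; case/orP: tuv => ->; rewrite ?orbT.
Qed.

(** The letters of a reduced word of [w] are recovered from its inversions, so
    [W_J] is a lower set of the weak order. *)
Lemma parabolic_reduced (J : {set S}) (w : W) :
  (forall t, odd_inv w t -> parabolic J t) -> parabolic J w.
Proof.
have [l [<- sl]] := reduced_word_exists w.
elim: l sl {w} => [|s l IH] /= sl wJ.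
  by rewrite wprod_nil; apply: parabolic1.
have [lenl ls] := reduced_cons sl.
rewrite wprod_cons in wJ *.
have us : odd_inv (gen s * wprod l) (gen s).
  by rewrite odd_inv_mul_self ?ls //; apply: gen_reflection.
have sJ := wJ _ us.
apply: parabolicM => //; apply: IH => // t lt.
rewrite -(conjgK (gen s) t); apply: parabolicJ; last exact: parabolicV.
apply: wJ; rewrite odd_inv_gen_mul lt addbT.
by apply: contraFneq ls => <-.
Qed.

Lemma parabolic_weak_le (J : {set S}) (u w : W) :
  weak_le u w -> parabolic J w -> parabolic J u.
Proof.
move=> uw wJ; apply: parabolic_reduced => t ut.
exact: parabolic_odd_inv wJ (weak_le_odd_inv uw ut).
Qed.

(** A shortest element [y] of the coset [W_J w] has no inversion in [W_J]; if
    [w = x y] with [x] in [W_J], the cocycle identity shows that [x] and [w]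
    have the same inversions in [W_J]. *)
Lemma parabolic_part_exists (J : {set S}) (w : W) : exists v : W,
  parabolic J v /\ inversions v = (inversions w `&` parabolic J)%classic.
Proof.
pose P n := `[< exists x : W, parabolic J x /\ len (x^-1 * w) = n >].
have exP : exists n, P n.
  exists (len w); apply/asboolP; exists 1; rewrite invg1 mul1g.
  by split=> //; apply: parabolic1.
case: (ex_minnP exP) => n /asboolP[x [xJ xn]] nmin.
have same t : parabolic J t -> reflection t -> odd_inv w t = odd_inv x t.
  move=> tJ tP; rewrite -{1}(mulVKg x w) odd_invM.
  suff /negPf -> : ~~ odd_inv (x^-1 * w) (t ^ x) by rewrite addbF.
  rewrite odd_invP; last exact: reflectionJ.
  rewrite -leqNgt xn; apply: nmin; apply/asboolP; exists (x * (t ^ x)^-1).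
  split; last by rewrite invgM invgK mulgA.
  by apply: parabolicM => //; apply: parabolicV; apply: parabolicJ.
exists x; split=> //; rewrite !inversionsE; apply/seteqP; split=> t /=.
  move=> xt; have tJ := parabolic_odd_inv xJ xt; split=> //.
  by move: (xt); rewrite -(same t tJ (odd_inv_reflection xt)).
by case=> wt tJ; rewrite -(same t tJ (odd_inv_reflection wt)).
Qed.

End WeakOrder.

(** * The geometric representation and distinctness of the generators *)

Section Geometric.
Variable W : coxeterSystem.
Local Notation S := (simple W).
Local Notation m := (@cox_mat W).
Import GRing.Theory Num.Theory.
Local Open Scope ring_scope.

(** A primitive root of unity of order [2 n]; the default value at [n = 0] serves
    the pairs of generators without relation. *)
Definition half_root (n : nat) : algC :=
  if n is n'.+1 then sval (@C_prim_root_exists n'.+1.*2 isT) else 1.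

Lemma half_rootP n : (0 < n)%N -> n.*2.-primitive_root (half_root n).
Proof.
by case: n => // n _; exact: (svalP (@C_prim_root_exists n.+1.*2 isT)).
Qed.

(** Minus the doubled Gram matrix of the simple roots, up to Galois conjugation:
    off the diagonal, the sum of a primitive root of unity of order [2 m] and its
    inverse is a conjugate of [2 cos (pi / m)]. *)
Definition geom_coef (s t : S) : algC :=
  if s == t then - 2%:R else half_root (m s t) + (half_root (m s t))^-1.

(** The action of a generator on coordinate functions, contragredient to its
    action on the simple roots. *)
Definition geom_step (s : S) (f : S -> algC) : S -> algC :=
  fun u => f u + geom_coef s u * f s.

Definition geom_act (l : seq S) (f : S -> algC) : S -> algC :=
  foldr geom_step f l.

Lemma geom_act_cat u v f : geom_act (u ++ v) f = geom_act u (geom_act v f).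
Proof. exact: foldr_cat. Qed.

(** The values at [t] and [s] met along the alternating word form a sequence
    [p_k] with [p_(k+1) + p_(k-1) = (z + z^-1) p_k], hence [A z^k + B z^-k];
    the other values only accumulate the sums of the even and odd [p_k]. *)
Lemma geom_act_alternating (s t : S) (z w A B : algC) f k :
  z * w = 1 -> geom_coef s t = z + w -> geom_coef t s = z + w ->
  f t = A + B -> f s = - (A * w + B * z) ->
  let g := geom_act (flatten (nseq k [:: s; t])) f in
  [/\ forall u, g u = f u
        + geom_coef t u * (A * (\sum_(j < k) (z ^+ 2) ^+ j)
                           + B * (\sum_(j < k) (w ^+ 2) ^+ j))
        + geom_coef s u * (A * z * (\sum_(j < k) (z ^+ 2) ^+ j)
                           + B * w * (\sum_(j < k) (w ^+ 2) ^+ j)),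
      g t = A * (z ^+ 2) ^+ k + B * (w ^+ 2) ^+ k
    & g s = - (A * w * (z ^+ 2) ^+ k + B * z * (w ^+ 2) ^+ k)].
Proof.
move=> zw cst cts ft fs.
have cdiag x : geom_coef x x = - 2%:R by rewrite /geom_coef eqxx.
elim: k => [|k [IHu IHt IHs]] /=.
  split=> [u||]; rewrite ?big_ord0 ?mulr0 ?addr0 ?mulr0 ?addr0 ?expr0 ?mulr1 //.
set g := geom_act _ f in IHu IHt IHs *.
have hs : geom_step t g s
    = A * z * (z ^+ 2) ^+ k + B * w * (w ^+ 2) ^+ k.
  by rewrite /geom_step cts IHt IHs; ring.
split=> [u||].
- rewrite {1}/geom_step hs /geom_step IHu IHt !big_ord_recr /=.
  ring.
- rewrite {1}/geom_step hs /geom_step cdiag cst IHt !(exprS _ k).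
  ring: zw.
- rewrite {1}/geom_step hs cdiag !(exprS _ k).
  ring: zw.
Qed.

Lemma geom_act_relator (s t : S) f :
  geom_act (flatten (nseq (m s t) [:: s; t])) f = f.
Proof.
have [mss msym mne1] := cox_matP W.
have [<-|st] := eqVneq s t.
  rewrite mss; apply: funext => u.
  have css : geom_coef s s = - 2%:R by rewrite /geom_coef eqxx.
  by rewrite /= /geom_step css; ring.
have [->//|m_gt0] := posnP (m s t).
have m_gt1 : (1 < m s t)%N by have := mne1 s t st; case: (m s t) m_gt0 => [|[]].
have prim := half_rootP m_gt0; set z := half_root (m s t) in prim.
have z0 : z != 0 by rewrite (prim_root_eq0 prim) double_eq0 -lt0n.
have x1 : z ^+ 2 != 1.
  rewrite -(prim_order_dvd prim) -muln2 (@dvdn_pmul2r 2 _ 1) //.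
  by rewrite dvdn1 neq_ltn m_gt1 orbT.
have sum0 (x : algC) : x != 1 -> x ^+ m s t = 1 -> \sum_(j < m s t) x ^+ j = 0.
  move=> xn1 xm; apply/eqP; have := subrX1 x (m s t); rewrite xm subrr.
  by move/esym/eqP; rewrite mulf_eq0 subr_eq0 (negPf xn1).
have xm : (z ^+ 2) ^+ m s t = 1 by rewrite -exprM mul2n prim_expr_order.
have ym : (z^-1 ^+ 2) ^+ m s t = 1 by rewrite !exprVn xm invr1.
have y1 : z^-1 ^+ 2 != 1 by rewrite exprVn invr_eq1.
have zz : z ^+ 2 - 1 != 0 by rewrite subr_eq0.
(* [A + B = f t] and [A z^-1 + B z = - f s] *)
pose B := - (z * f s + f t) / (z ^+ 2 - 1).
have [] := @geom_act_alternating s t z z^-1 (f t - B) B f (m s t).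
- exact: divff.
- by rewrite /geom_coef (negPf st).
- by rewrite /geom_coef eq_sym (negPf st) msym.
- by rewrite subrK.
- by rewrite /B; field; rewrite z0 zz.
move=> gE _ _; apply: funext => u.
by rewrite gE !sum0 // !mulr0 !addr0 !mulr0 !addr0.
Qed.

Lemma geom_act_equiv u v f :
  coxeter_equiv m u v -> geom_act u f = geom_act v f.
Proof.
elim=> {u v}[u v s t|//|u v _ -> //|u v w _ -> _ -> //].
by rewrite !geom_act_cat geom_act_relator.
Qed.

(** The coordinate at [s] of the basis function of [s] is negated by [s] and
    fixed by every other generator. *)
Lemma simple_gen_inj : injective (@simple_gen W).
Proof.
move=> s t st; apply/eqP/negP => /negP ne.
have : coxeter_equiv m [:: s] [:: t].
  by apply/cox_presented; rewrite !big_seq1.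
move/(@geom_act_equiv _ _ (fun u => (u == s)%:R))/(congr1 (fun f => f s)).
rewrite /= /geom_step eqxx [t == s]eq_sym (negPf ne) {1}/geom_coef eqxx.
rewrite mulr0 addr0 mulr1 => /eqP.
by rewrite -subr_eq0 addrAC subrr sub0r oppr_eq0 pnatr_eq0.
Qed.

End Geometric.

(** * Products of distinct generators *)

Section UniqWords.
Variable W : coxeterSystem.
Local Notation S := (simple W).

(** A reduced word over [J] for a generator has at most one letter; it is not
    empty since a generator crosses itself, and it is the given generator since
    distinct generators differ in [W]. *)
Lemma gen_parabolic (J : {set S}) (s : S) :
  parabolic J (simple_gen s : W) -> s \in J.
Proof.
move=> /parabolicP[l [lJ sE]].
have [[|s' [|s'' k]] [kl kE ksz]] := reduced_subseq l; last first.
- by have := len_gen s; rewrite sE -ksz.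
- move: kE; rewrite -sE wprod_cons wprod_nil mulg1 => /simple_gen_inj <-.
  by apply/lJ/kl; rewrite mem_head.
have := odd_inv_gen s (simple_gen s).
by rewrite {1}sE -kE wprod_nil odd_inv1 eqxx.
Qed.

(** If the letter [s] occurs once in a word, it can be solved for in terms of
    the product and of the other letters. *)
Lemma uniq_word_parabolic (J : {set S}) (l : seq S) :
  uniq l -> parabolic J (wprod l : W) -> {subset l <= J}.
Proof.
move=> ul lJ s sl; apply/negPn/negP => sJ.
case/splitPr: l / sl ul lJ => u v.
rewrite uniq_catC /= => /andP[]; rewrite mem_cat negb_or => /andP[sv su] _.
move=> lJ.
have rest (r : seq S) : s \notin r -> parabolic [set~ s] (wprod r : W).
  move=> sr; apply: parabolic_wprod => x xr; rewrite !inE.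
  by apply: contraNneq sr => <-.
have : parabolic [set~ s] (simple_gen s : W).
  have -> : simple_gen s = (wprod u)^-1 * (wprod (u ++ s :: v) / wprod v).
    by rewrite wprod_cat wprod_cons !mulgA mulVg mul1g mulgK.
  apply: parabolicM; first by apply: parabolicV; apply: rest.
  apply: parabolicM; last by apply: parabolicV; apply: rest.
  apply: parabolicS lJ; apply/fintype.subsetP => x xJ; rewrite !inE.
  by apply: contraNneq sJ => <-.
by move/gen_parabolic; rewrite !inE eqxx.
Qed.

End UniqWords.

(** * Acyclic sets and the element c(Omega, J) *)

Section Acyclic.
Variables (W : coxeterSystem) (Omega : orientation W).
Local Notation S := (simple W).

Lemma acyclicS (J K : {set S}) :
  J \subset K -> acyclic Omega K -> acyclic Omega J.
Proof.
move=> /fintype.subsetP JK Kac [p [p0 pJ pc]]; apply: Kac.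
by exists p; split=> // x /pJ/JK.
Qed.

(** Otherwise iterating a choice of successor runs into a cycle. *)
Lemma acyclic_sink (J : {set S}) : acyclic Omega J -> J != finset.set0 ->
  exists2 s, s \in J & forall t, t \in J -> ~~ Omega s t.
Proof.
move=> Jac /finset.set0Pn[x0 x0J].
apply: contrapT => nosink.
pose f s := odflt s [pick t in J | Omega s t].
have fP s : s \in J -> f s \in J /\ Omega s (f s).
  move=> sJ; rewrite /f; case: pickP => [t /andP[]|nt] //=.
  by case: nosink; exists s => // t tJ; have := nt t; rewrite tJ /= => ->.
have iterJ n : iter n f x0 \in J by elim: n => //= n /fP[].
have [i [j [ij e]]] : exists i j, (i < j)%N /\ iter i f x0 = iter j f x0.
  apply: contrapT => noeq.
  have inj : injective (fun i : 'I_#|S|.+1 => iter i f x0).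
    move=> i j e; apply: val_inj; apply: contrapT => /eqP; rewrite neq_ltn.
    by case/orP=> ij; apply: noeq; [exists i, j|exists j, i].
  by have := leq_card _ inj; rewrite card_ord ltnn.
set x := iter i f x0 in e.
have cyc : fcycle f (orbit f x).
  apply/(@orbitPcycle _ f x 0 3); exists (j - i).-1.
  by rewrite prednK ?subn_gt0 // /x -iterD subnK // ltnW.
have xJ n : iter n f x \in J by rewrite /x -iterD iterJ.
have oJ : {subset orbit f x <= J}.
  by move=> y; rewrite -fconnect_orbit => /iter_findex <-.
apply: Jac; exists (orbit f x); split=> //.
  by rewrite -size_eq0 size_orbit -lt0n order_gt0.
rewrite /ucycle orbit_uniq andbT.
apply: (sub_in_cycle (P := mem J)) cyc; last exact/allP.
by move=> y z yJ _ /eqP <-; case: (fP y yJ).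
Qed.

(** Arrows must lead from later to earlier letters, so that a sink can be put
    first. *)
Lemma acyclic_ordering (J : {set S}) :
  acyclic Omega J -> exists l, compatible_ordering Omega J l.
Proof.
have [n] := ubnP #|J|; elim: n J => // n IH J Jn Jac.
have [->|J0] := eqVneq J finset.set0.
  by exists [::]; split=> // [s|s t]; rewrite !inE.
have [s sJ sink] := acyclic_sink Jac J0.
have [] := IH (J :\ s); first by move: Jn; rewrite (cardsD1 s) sJ.
  by apply: acyclicS Jac; apply: subsetDl.
move=> l [ul lJ lord]; exists (s :: l); split=> [|t|a b aJ bJ ba].
- by rewrite /= ul lJ !inE eqxx.
- by rewrite !inE lJ !inE; case: eqP => // ->.
have sb : s != b by apply: contraNneq (sink _ aJ) => ->.
rewrite /= (negPf sb); case: eqVneq => // sa; rewrite ltnS.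
by apply: lord; rewrite // !inE eq_sym ?sa ?sb.
Qed.

Lemma cox_eltP (J : {set S}) : acyclic Omega J ->
  exists l : seq S, [/\ uniq l, l =i J & wprod l = cox_elt Omega J].
Proof.
move=> /acyclic_ordering[l lP].
have [|k [ku kJ _] kE] := @xgetPex W 1
    [set wprod k | k in compatible_ordering Omega J]%classic.
  by exists (wprod l), l.
by exists k.
Qed.

Lemma cox_elt_parabolic (J K : {set S}) : acyclic Omega J ->
  parabolic K (cox_elt Omega J) <-> J \subset K.
Proof.
move=> /cox_eltP[l [ul lJ <-]]; split=> [lK|/fintype.subsetP JK].
  by apply/fintype.subsetP => s; rewrite -lJ; apply: uniq_word_parabolic.
by apply: parabolic_wprod => s; rewrite lJ => /JK.
Qed.

Lemma acyclic0 : acyclic Omega finset.set0.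
Proof. by case=> [[|s p] [//= _ /(_ s (mem_head _ _))]]; rewrite inE. Qed.

Lemma acyclic1 (s : S) : acyclic Omega [set s].
Proof.
case=> [[|x [|y p]] [//= _ sub /andP[pc pu]]].
  by move: pc; rewrite /= andbT => xx; have := arrow_asym Omega x x; rewrite xx.
have := sub x; rewrite !inE eqxx => /(_ isT)/eqP xs.
have := sub y; rewrite !inE eqxx orbT => /(_ isT)/eqP ys.
by move: pu; rewrite xs ys /= mem_head.
Qed.

Lemma cox_elt_eq1 (J : {set S}) :
  acyclic Omega J -> (cox_elt Omega J = 1) <-> (J = finset.set0).
Proof.
move=> Jac; split=> [J1|J0].
  apply/eqP; rewrite -finset.subset0; apply/(cox_elt_parabolic _ Jac).
  by rewrite J1; apply: parabolic1.
have [[|s l] [_ lJ <-]] := cox_eltP Jac; first exact: wprod_nil.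
by have := lJ s; rewrite mem_head J0 inE.
Qed.

Lemma cox_elt1 (s : S) : cox_elt Omega [set s] = simple_gen s.
Proof.
have [l [ul ls <-]] := cox_eltP (@acyclic1 s).
have /perm_small_eq -> // : perm_eq l [:: s].
  by apply: uniq_perm => // x; rewrite ls !inE.
by rewrite wprod_cons wprod_nil mulg1.
Qed.

Lemma max_acyclicP (w : W) :
  maxset (fun J => `[< acyclic_below Omega w J >]) (max_acyclic Omega w).
Proof.
pose P J := `[< acyclic_below Omega w J >].
apply: (@xgetPex _ finset.set0 [set J | maxset P J]%classic).
have [|J Jmax _] := @maxset_exists _ P finset.set0.
  apply/asboolP; split; first exact: acyclic0.
  have /(cox_elt_eq1 acyclic0) -> := erefl (@finset.set0 S).
  exact: weak_le1.
by exists J.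
Qed.

Lemma max_acyclic_below (w : W) : acyclic_below Omega w (max_acyclic Omega w).
Proof. exact/asboolP/(maxsetp (max_acyclicP w)). Qed.

Lemma first_descent (w : W) : w != 1 -> exists s : S, odd_inv w (simple_gen s).
Proof.
have [[|s l] [<- sl]] := reduced_word_exists w; first by rewrite wprod_nil eqxx.
have [_ ls] := reduced_cons sl => _; exists s.
by rewrite wprod_cons odd_inv_mul_self ?ls //; apply: gen_reflection.
Qed.

(** If [s] is the first letter of a reduced word of [w], then [{s}] is acyclic
    and [c(Omega, {s}) = s <= w], so that the empty set is not maximal. *)
Lemma max_acyclic_eq0 (w : W) : (max_acyclic Omega w = finset.set0) <-> (w = 1).
Proof.
have [Jac Jw] := max_acyclic_below w; split=> [J0|w1]; last first.
  apply/(cox_elt_eq1 Jac)/len_eq0/eqP; rewrite -leqn0 -(len1 W) -w1 -Jw.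
  exact: leq_addr.
apply/eqP/negPn/negP => /first_descent[s sw].
have : [set s] = max_acyclic Omega w.
  apply: (maxsetsup (max_acyclicP w)); last by rewrite J0 finset.sub0set.
  apply/asboolP; split; first exact: acyclic1.
  by rewrite cox_elt1; apply: weak_le_gen.
by rewrite J0 => /setP/(_ s); rewrite !inE eqxx.
Qed.

End Acyclic.

(** * The projection *)

Section Projection.
Variables (W : coxeterSystem) (Omega : orientation W).
Local Notation S := (simple W).
Local Notation Jm := (max_acyclic Omega).
Local Notation c := (cox_elt Omega).

Lemma parabolic_partP (J : {set S}) (w : W) :
  parabolic J (parabolic_part J w) /\
  forall t, odd_inv (parabolic_part J w) t <-> odd_inv w t /\ parabolic J t.
Proof.
have [vJ vE] := xgetPex 1 (parabolic_part_exists J w).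
split=> // t; move: vE; rewrite -/(parabolic_part J w) !inversionsE.
by move/(congr1 (fun A => A t)) => /= ->.
Qed.

Lemma parabolic_part_le (J : {set S}) (w : W) : weak_le (parabolic_part J w) w.
Proof.
by apply: odd_inv_weak_le => t; case: (parabolic_partP J w) => _ -> [].
Qed.

(** Both relations are containments of inversion sets, and the inversions of an
    element of [W_J] are themselves in [W_J]. *)
Lemma le_parabolic_part (J : {set S}) (u w : W) :
  parabolic J u -> weak_le u w -> weak_le u (parabolic_part J w).
Proof.
move=> uJ uw; apply: odd_inv_weak_le => t ut.
have [_ ->] := parabolic_partP J w.
by split; [apply: weak_le_odd_inv ut|apply: parabolic_odd_inv ut].
Qed.

Lemma parabolic_part_id (J : {set S}) (w : W) :
  parabolic J w <-> parabolic_part J w = w.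
Proof.
split=> [wJ|<-]; last by have [] := parabolic_partP J w.
apply: weak_le_anti; first exact: parabolic_part_le.
by apply: le_parabolic_part => //; apply: weak_le_refl.
Qed.

Lemma sortable1 : sortable Omega (1 : W).
Proof.
have J1 : Jm 1 = finset.set0 by apply/max_acyclic_eq0.
have c1 : c (Jm 1) = 1.
  by apply/cox_elt_eq1 => //; rewrite J1; apply: acyclic0.
have step1 i : sort_step Omega (1 : W) i = 1.
  by elim: i => //= i ->; rewrite c1 mulVg.
by move=> i; rewrite !step1.
Qed.

Lemma sort_stepS (w : W) i :
  sort_step Omega w i.+1 = sort_step Omega ((c (Jm w))^-1 * w) i.
Proof. exact: iterSr. Qed.

Lemma sortable_step (w : W) : sortable Omega w <->
  Jm ((c (Jm w))^-1 * w) \subset Jm w /\ sortable Omega ((c (Jm w))^-1 * w).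
Proof.
split=> [sw|[J2 sw] [|i]]; first split=> [|i].
- exact: (sw 0%N).
- by have := sw i.+1; rewrite (sort_stepS w i.+1) (sort_stepS w i).
- exact: J2.
- by rewrite (sort_stepS w i.+1) (sort_stepS w i); apply: sw.
Qed.

(** The recursion of the projection terminates within its bound: the factor
    that is stripped off is nontrivial, since [J(w, Omega)] is nonempty. *)
Lemma len_step (u w : W) : w != 1 -> weak_le (c (Jm w)) u -> weak_le u w ->
  (len ((c (Jm w))^-1 * u) < len w)%N.
Proof.
move=> w1 cu uw; have [Jac _] := max_acyclic_below Omega w.
have lt : (len u <= len w)%N by rewrite -uw leq_addr.
apply: leq_trans lt; rewrite -cu -add1n leq_add2r lt0n.
apply: contra w1 => /eqP/len_eq0.
by move/(cox_elt_eq1 Jac)/max_acyclic_eq0 => ->.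
Qed.

(** The factors [c(Omega, J_i)], whose product is [w], all lie in [W_(J_1)]
    because the sets [J_i] decrease. *)
Lemma sortable_parabolic (w : W) : sortable Omega w -> parabolic (Jm w) w.
Proof.
have [n] := ubnP (len w); elim: n w => // n IH w wn sw.
have [w1|w1] := eqVneq w 1; first by rewrite {2}w1; apply: parabolic1.
have [Jac cw] := max_acyclic_below Omega w.
have /sortable_step[J2 sw2] := sw.
rewrite -{2}(mulVKg (c (Jm w)) w).
apply: parabolicM; first exact/cox_elt_parabolic.
apply: parabolicS J2 _; apply: IH => //.
rewrite (leq_trans (len_step w1 cw _)) //.
exact: weak_le_refl.
Qed.

(** Stated for any sufficient recursion bound, so that the induction on the bound
    covers the recursive call. *)
Lemma pi_down_recP n (w : W) : (len w <= n)%N ->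
  weak_le (pi_down_rec Omega n w) w /\
  (pi_down_rec Omega n w = w <-> sortable Omega w).
Proof.
elim: n w => [|n IH] w wn /=.
  have w1 : w = 1 by apply/len_eq0/eqP; rewrite -leqn0.
  rewrite w1; split; first exact: weak_le_refl.
  by split=> // _; apply: sortable1.
case: eqVneq => [->|w1].
  split; first exact: weak_le_refl.
  by split=> // _; apply: sortable1.
set J := Jm w; have [Jac cw] : acyclic_below Omega w J := max_acyclic_below _ w.
have cJ : parabolic J (c J) by apply/cox_elt_parabolic.
have cwJ := le_parabolic_part cJ cw.
have wJw := parabolic_part_le J w.
have [|le2 eq2] := IH ((c J)^-1 * parabolic_part J w).
  by rewrite -ltnS (leq_trans (len_step w1 cwJ wJw)).
have le1 := weak_le_mul cwJ le2.
split; first exact: weak_le_trans le1 wJw.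
split=> [eqw|sw].
  have wJ : parabolic_part J w = w.
    by apply: weak_le_anti => //; rewrite -{1}eqw.
  rewrite wJ in eq2 eqw.
  apply/sortable_step; split; last by apply/eq2; rewrite -{2}eqw mulKg.
  have [Jac2 cw2] := max_acyclic_below Omega ((c J)^-1 * w).
  apply/(cox_elt_parabolic _ Jac2); apply: parabolic_weak_le cw2 _.
  by apply: parabolicM; [apply: parabolicV|apply/parabolic_part_id].
have /parabolic_part_id wJ := sortable_parabolic sw.
have /sortable_step[_ sw2] := sw.
rewrite wJ in eq2 *; rewrite (proj2 eq2 sw2).
exact: mulVKg.
Qed.

End Projection.

Theorem proposition1p4 (W : coxeterSystem) (Omega : orientation W) (w : W) :
  weak_le (pi_down Omega w) w /\ (pi_down Omega w = w <-> sortable Omega w).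
Proof. exact: pi_down_recP. Qed.
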